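(* Let $\rho^0,\rho^1$ be given density evolutions and let $(\hat\rho^i,\hat m^i)=\operatorname{argmin}_{(\tilde\rho,\tilde m)\in C}J(\tilde\rho,\tilde m;\rho^i)$, $i=0,1$. If the terminal cost $f_T(x,\rho_T)=f_T(x)$ is independent of $\rho_T$, then $$\langle\hat\rho^0-\hat\rho^1,\,f(\rho^0)-f(\rho^1)\rangle_{Q_T}+D=0,$$ where $D\ge0$, and $D=0$ if and only if $\hat\rho^0=\hat\rho^1$.
   Context: **Domain and notation.** Fix $T>0$, $\nu>0$, $\mathbb T^d=\mathbb R^d/\mathbb Z^d$, $Q_T=\mathbb T^d\times(0,T)$. $\langle\cdot,\cdot\rangle_{\mathbb T^d},\|\cdot\|_{\mathbb T^d}$ and $\langle\cdot,\cdot\rangle_{Q_T},\|\cdot\|_{Q_T}$ are the $L^2$ inner products and norms on $\mathbb T^d$ and $Q_T$. $\mathcal P(\mathbb T^d)$ is the set of Borel probability measures on $\mathbb T^d$; an absolutely continuous measure is identified with its density. A density evolution is $\rho=(\rho_t)_{t\in[0,T]}$ with $\rho_t=\rho(\cdot,t)\in\mathcal P(\mathbb T^d)$; $\rho>0$ means the density is positive everywhere. **Standing assumptions on the data.** $\rho_0$ is a probability measure on $\mathbb T^d$ with a $C^2$ positive density. The Hamiltonian $H:\mathbb T^d\times\mathbb R^d\to\mathbb R$, $(x,p)\mapsto H(x,p)$, is $C^2$ in $x$, smooth and strictly convex in $p$, and $\lim_{|p|\to\infty}H(x,p)/|p|=+\infty$ for all $x$. The interaction cost $f$ is either nonlocal,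 $f:\mathbb T^d\times\mathcal P(\mathbb T^d)\to\mathbb R$ with $f(\cdot,\rho)\in C^2(\mathbb T^d)$ for each $\rho\in\mathcal P(\mathbb T^d)$, or local, $f\in C^2(\mathbb T^d\times[0,\infty))$, in which case $f(x,\rho)$ means $f(x,\rho(x))$ for a density $\rho$. The terminal cost $f_T$ is likewise nonlocal with $f_T(\cdot,\rho)\in C^3(\mathbb T^d)$, or local with $f_T\in C^3(\mathbb T^d\times[0,\infty))$. For a density evolution $\rho$, $f(\rho)$ is the function $(x,t)\mapsto f(x,\rho_t)$ and $f_T(\rho_T)$ is $x\mapsto f_T(x,\rho_T)$. **Constraint set and costs.** $C$ is the set of $(\rho,m)$ with $\rho\in C([0,T],L^1(\mathbb T^d)\cap\mathcal P(\mathbb T^d))$, $m\in L^1(\mathbb T^d\times[0,T];\mathbb R^d)$, $\rho(\cdot,0)=\rho_0$ and $\partial_t\rho-\nu\Delta\rho+\nabla\cdot m=0$ in the sense of distributions. $L(x,v)=\sup_p\{-\langle p,v\rangle-H(x,p)\}$. The dynamic cost is $R(\rho,m)=\int_0^T\int_{\mathbb T^d}\rho\,L(x,m/\rho)\,dx\,dt$, where for $\rho=0$, $L(x,m/\rho):=0$ if $m=0$ and $+\infty$ if $m\ne0$. For $(\tilde\rho,\tilde m)\in C$ and a density evolution $\rho$, $J(\tilde\rho,\tilde m;\rho)=R(\tilde\rho,\tilde m)+\langle f(\rho),\tilde\rho\rangle_{Q_T}+\langle f_T(\rho_T),\tilde\rho_T\rangle_{\mathbb T^d}$. **Well-posedness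 convention.** The density evolutions $\rho$ for which $\operatorname{argmin}_{C}J(\cdot,\cdot;\rho)$ (the best response) is considered are regular enough that the backward equation $-\partial_t\hat\phi-\nu\Delta\hat\phi+H(x,\nabla\hat\phi)=f(x,\rho_t)$ in $Q_T$, $\hat\phi(\cdot,T)=f_T(\cdot,\rho_T)$ has a unique classical solution $\hat\phi$ and the forward equation $\partial_t\hat\rho-\nu\Delta\hat\rho-\nabla\cdot(\hat\rho D_pH(x,\nabla\hat\phi))=0$, $\hat\rho(\cdot,0)=\rho_0$ has a unique classical solution, which is positive; the best response exists, is unique, and equals $(\hat\rho,-\hat\rho D_pH(\cdot,\nabla\hat\phi))$. (The paper asserts this as a standard fact when $\rho\in C^2(\overline{Q_T})$, $\rho>0$, $\rho(\cdot,t)\in\mathcal P(\mathbb T^d)$, $\rho(\cdot,0)=\rho_0$.) *)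

(* Defs.v *)
From HB Require Import structures.
From mathcomp Require Import all_boot all_order all_algebra.
From mathcomp Require Import all_classical all_reals all_analysis.
Import Order.TTheory GRing.Theory Num.Theory.
Import numFieldNormedType.Exports.

Set Implicit Arguments.
Unset Strict Implicit.
Unset Printing Implicit Defensive.

Local Open Scope classical_set_scope.
Local Open Scope ring_scope.

(* Conventions.
   - R^d is 'rV[R]_d.  A function on the torus R^d/Z^d is a Z^d-periodic
     function on R^d; a Borel measure on the torus is a Borel measure on R^d
     carried by the fundamental cell [0, 1)^d.
   - A function on space-time is u : R -> 'rV[R]_d -> _, time first; its values
     at times outside [0, T] are never used. *)

(* The sigma-algebra generated by the coordinates, i.e. the Borel sets of R^d. *)
Fact rV_measurable_set0 (R : realType) d :
  g_sigma_preimage (fun (i : 'I_d) (x : 'rV[R]_d) => x ord0 i) set0.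
Proof. exact: sigma_algebra0. Qed.

Fact rV_measurable_setC (R : realType) d (A : set 'rV[R]_d) :
  g_sigma_preimage (fun (i : 'I_d) (x : 'rV[R]_d) => x ord0 i) A ->
  g_sigma_preimage (fun (i : 'I_d) (x : 'rV[R]_d) => x ord0 i) (~` A).
Proof. exact: sigma_algebraC. Qed.

Fact rV_measurable_bigcup (R : realType) d (F : (set 'rV[R]_d)^nat) :
  (forall k,
    g_sigma_preimage (fun (i : 'I_d) (x : 'rV[R]_d) => x ord0 i) (F k)) ->
  g_sigma_preimage (fun (i : 'I_d) (x : 'rV[R]_d) => x ord0 i) (\bigcup_k F k).
Proof. exact: sigma_algebra_bigcup. Qed.

HB.instance Definition _ (R : realType) d :=
  @isMeasurable.Build default_measure_display 'rV[R]_d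
    (g_sigma_preimage (fun (i : 'I_d) (x : 'rV[R]_d) => x ord0 i))
    (@rV_measurable_set0 R d) (@rV_measurable_setC R d)
    (@rV_measurable_bigcup R d).

Definition rV_cons (R : realType) d (z : measurableTypeR R * 'rV[R]_d) : 'rV[R]_d.+1 :=
  row_mx (const_mx z.1 : 'rV_1) z.2.

Fact measurable_rV_coord (R : realType) d (i : 'I_d) :
  measurable_fun [set: 'rV[R]_d] (fun x : 'rV[R]_d => x ord0 i).
Proof.
move=> _ Y mY; rewrite setTI; apply: sub_sigma_algebra => /=.
rewrite -bigcup_seq/=; exists i => /=; first by rewrite mem_index_enum.
by exists Y => //; rewrite setTI.
Qed.

Fact measurable_rV_cons (R : realType) d :
  measurable_fun [set: measurableTypeR R * 'rV[R]_d] (@rV_cons R d).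
Proof.
have mc (i : 'I_d.+1) :
    measurable_fun [set: measurableTypeR R * 'rV[R]_d] (fun z => rV_cons z ord0 i).
  rewrite /rV_cons; case: (splitP (i : 'I_(1 + d))) => [j ij|j ij].
    rewrite (_ : (fun z => _) = fst); first exact: measurable_fst.
    apply/funext => z; have -> : i = lshift d j by exact/val_inj.
    by rewrite (row_mxEl (const_mx z.1 : 'rV_1)) mxE.
  rewrite (_ : (fun z => _) = (fun x : 'rV[R]_d => x ord0 j) \o snd).
    by apply: measurableT_comp; [exact: measurable_rV_coord|
                                 exact: measurable_snd].
  apply/funext => z; have -> : i = rshift 1 j by exact/val_inj.
  by rewrite (row_mxEr (const_mx z.1 : 'rV_1)).
move=> _ Y mY; rewrite setTI.
suff : <<s \big[setU/set0]_(i < d.+1) preimage_set_system setT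
          (fun x : 'rV[R]_d.+1 => x ord0 i) measurable >> `<=`
       [set A | measurable (@rV_cons R d @^-1` A)] by exact.
apply: smallest_sub.
  split=> [|A /= mA|F /= mF]; first by rewrite /= preimage_set0.
    by rewrite setTD preimage_setC; exact: measurableC.
  by rewrite preimage_bigcup; exact: bigcup_measurable.
rewrite -bigcup_seq/=; apply: bigcup_sub => i _ A [B mB <-] /=.
by rewrite setTI; have := mc i measurableT B mB; rewrite setTI.
Qed.

HB.instance Definition _ (R : realType) d :=
  isMeasurableFun.Build _ _ _ _ (@rV_cons R d) (@measurable_rV_cons R d).

(* Normalised Haar measure of the torus: the d-fold product of the Lebesgue
   measure of [0, 1], built one coordinate at a time. *)
Fixpoint haar (R : realType) d : probability 'rV[R]_d R :=
  match d with
  | 0 => \d_(0 : 'rV[R]_0)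
  | d'.+1 => distribution (uniform_prob (@ltr01 R) \x haar R d')%E
               (@rV_cons R d')
  end.

Section torus.
Context (R : realType) (d : nat).
Notation V := 'rV[R]_d.
Notation ST := (measurableTypeR R * 'rV[R]_d)%type.

Definition periodic (A : Type) (u : V -> A) :=
  forall (x : V) (i : 'I_d), u (x + delta_mx ord0 i) = u x.

Definition dot (p q : V) : R := \sum_i p ord0 i * q ord0 i.

(* The library norm on 'rV[R]_d is the sup norm; this is the Euclidean one. *)
Definition enorm (p : V) : R := Num.sqrt (dot p p).

Definition partial (i : 'I_d) (u : V -> R) : V -> R :=
  'D_(delta_mx ord0 i) u.

Definition grad (u : V -> R) (x : V) : V := \row_i partial i u x.

Definition laplacian (u : V -> R) (x : V) : R :=
  \sum_i partial i (partial i u) x.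

Definition divergence (w : V -> V) (x : V) : R :=
  \sum_i partial i (fun y => w y ord0 i) x.

(* f is of class C^k on E: all directional derivatives up to order k exist and
   are continuous (used for finite-dimensional E only). *)
Fixpoint Ck (E : normedModType R) (k : nat) (f : E -> R) : Prop :=
  continuous f /\
  if k is k'.+1 then
    forall v, (forall x, derivable f x v) /\ Ck k' (fun x => 'D_v f x)
  else True.

Definition Cinfty (E : normedModType R) (f : E -> R) := forall k, Ck k f.

Definition strictly_convex (h : V -> R) :=
  forall (p q : V) (s : R), p != q -> 0 < s < 1 ->
    h (s *: p + (1 - s) *: q) < s * h p + (1 - s) * h q.

Definition superlinear (h : V -> R) :=
  forall A : R, exists B : R, forall p : V, B < enorm p -> A < h p / enorm p.

Definition unit_cell : set V := [set x | forall i, 0 <= x ord0 i < 1].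

(* P(T^d); singular measures are included. *)
Definition torus_prob := {mu : probability V R | mu unit_cell = 1%E}.

Definition is_density (u : V -> R) :=
  [/\ periodic u, measurable_fun [set: V] u, (forall x, 0 <= u x) &
      (\int[haar R d]_x (u x)%:E = 1)%E].

(* An absolutely continuous element of P(T^d), together with its density. *)
Record torus_density := TorusDensity {
  dens :> V -> R;
  law : torus_prob;
  dens_is_density : is_density dens;
  law_dens : forall A : set V, measurable A ->
    (sval law A = \int[haar R d]_(x in A) (dens x)%:E)%E
}.

Definition density_evolution := R -> torus_density.

Variant cost :=
  | Nonlocal of (V -> torus_prob -> R)
  | Local of (V -> R -> R).

Definition cost_at (c : cost) (mu : torus_density) (x : V) : R :=
  match c with
  | Nonlocal f => f x (law mu)
  | Local f => f x (mu x)
  end.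

(* C^k up to the boundary r = 0 of T^d x [0, +oo[ means being the restriction
   of a C^k function. *)
Definition cost_smooth (k : nat) (c : cost) : Prop :=
  match c with
  | Nonlocal f =>
      forall mu, periodic (fun x => f x mu) /\ Ck k (fun x => f x mu)
  | Local f =>
      (forall r, 0 <= r -> periodic (fun x => f x r)) /\
      exists2 g : V * R -> R, Ck k g & forall x r, 0 <= r -> f x r = g (x, r)
  end.

Record mfg_data := MFGData {
  horizon : R;
  viscosity : R;
  init : V -> R;
  hamiltonian : V -> V -> R;
  interaction : cost;
  terminal : cost
}.

Definition standing_assumptions (M : mfg_data) :=
  let H := hamiltonian M in
  [/\ 0 < horizon M,
      0 < viscosity M,
      [/\ is_density (init M), Ck 2 (init M) & forall x, 0 < init M x],
      [/\ (forall p, periodic (fun x => H x p)),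
          (forall p, Ck 2 (fun x => H x p)),
          (forall x, Cinfty (H x)),
          (forall x, strictly_convex (H x)) &
          (forall x, superlinear (H x))] &
      cost_smooth 2 (interaction M) /\ cost_smooth 3 (terminal M)].

Section data.
Variable M : mfg_data.
Notation T := (horizon M).
Notation nu := (viscosity M).
Notation H := (hamiltonian M).

Definition QT : set ST := [set z | 0 < z.1 < T].
Definition QT_closure : set ST := [set z | 0 <= z.1 <= T].

Definition muQ := (@lebesgue_measure R \x haar R d)%E.

Definition inner_QT (u v : R -> V -> R) : R :=
  \int[muQ]_(z in QT) (u z.1 z.2 * v z.1 z.2).

Definition square_integrable_QT (u : R -> V -> R) :=
  measurable_fun QT (fun z : ST => u z.1 z.2) /\
  muQ.-integrable QT (fun z : ST => (u z.1 z.2 ^+ 2)%:E).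

Definition test_function (psi : R -> V -> R) :=
  [/\ Cinfty (fun z : R * V => psi z.1 z.2),
      (forall t, periodic (psi t)) &
      exists a b, [/\ 0 < a, b < T &
        forall t x, ~~ (a <= t <= b) -> psi t x = 0]].

Definition dt (u : R -> V -> R) (t : R) (x : V) : R :=
  derive1 (fun s : R => u s x) t.

Definition continuity_equation (rho : R -> V -> R) (m : R -> V -> V) :=
  forall psi, test_function psi ->
    \int[muQ]_(z in QT)
      (rho z.1 z.2 * (dt psi z.1 z.2 + nu * laplacian (psi z.1) z.2)
       + dot (m z.1 z.2) (grad (psi z.1) z.2)) = 0.

(* Elements of C([0,T], L^1) and of L^1(Q_T) are given by jointly measurable
   representatives. *)
Definition constraint_set (rho : R -> V -> R) (m : R -> V -> V) :=
  [/\ [/\ (forall t, 0 <= t <= T -> is_density (rho t)),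
          measurable_fun QT_closure (fun z : ST => rho z.1 z.2) &
          forall t, 0 <= t <= T ->
            (\int[haar R d]_x `|rho s x - rho t x|%:E)%E
              @[s --> within [set s | 0 <= s <= T] (nbhs t)] --> 0%E],
      (forall t, 0 < t < T -> periodic (m t)) /\
      (forall i, muQ.-integrable QT (fun z : ST => (m z.1 z.2 ord0 i)%:E)),
      {ae haar R d, forall x, rho 0 x = init M x} &
      continuity_equation rho m].

Definition lagrangian (x v : V) : \bar R :=
  ereal_sup [set (- dot p v - H x p)%:E | p in [set: V]].

(* The integrand rho * L(x, m / rho), where for rho = 0 the whole integrand is
   0 if m = 0 and +oo otherwise (and not 0 * +oo = 0). *)
Definition running_cost (x : V) (r : R) (m : V) : \bar R :=
  if r == 0 then (if m == 0 then 0%E else +oo%E)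
  else (r%:E * lagrangian x (r^-1 *: m))%E.

Definition dynamic_cost (rho : R -> V -> R) (m : R -> V -> V) : \bar R :=
  (\int[muQ]_(z in QT) running_cost z.2 (rho z.1 z.2) (m z.1 z.2))%E.

Definition f_of (rho : density_evolution) (t : R) (x : V) : R :=
  cost_at (interaction M) (rho t) x.

Definition fT_of (rho : density_evolution) (x : V) : R :=
  cost_at (terminal M) (rho T) x.

Definition J (rho' : R -> V -> R) (m' : R -> V -> V)
    (rho : density_evolution) : \bar R :=
  (dynamic_cost rho' m'
   + \int[muQ]_(z in QT) (f_of rho z.1 z.2 * rho' z.1 z.2)%:E
   + \int[haar R d]_x (fT_of rho x * rho' T x)%:E)%E.

Definition best_response (rho : density_evolution)
    (rho' : R -> V -> R) (m' : R -> V -> V) :=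
  constraint_set rho' m' /\
  forall r m, constraint_set r m -> (J rho' m' rho <= J r m rho)%E.

(* Equality of elements of C([0,T], L^1). *)
Definition ae_eq_evolution (u v : R -> V -> R) :=
  forall t, 0 <= t <= T -> {ae haar R d, forall x, u t x = v t x}.

(* C^{2,1}(Q_T), continuous up to t = 0 and t = T. *)
Definition classical (u : R -> V -> R) :=
  [/\ (forall t, 0 <= t <= T -> periodic (u t)),
      {within (QT_closure : set (R * V)),
        continuous (fun z : R * V => u z.1 z.2)},
      (forall t x, 0 < t < T ->
        [/\ derivable (fun s : R => u s x) t 1,
            (forall i, derivable (u t) x (delta_mx ord0 i)) &
            (forall i j, derivable (partial i (u t)) x (delta_mx ord0 j))]),
      {within (QT : set (R * V)), continuous (fun z : R * V => dt u z.1 z.2)} &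
      (forall i, {within (QT : set (R * V)),
        continuous (fun z : R * V => partial i (u z.1) z.2)}) /\
      (forall i j, {within (QT : set (R * V)),
        continuous (fun z : R * V => partial j (partial i (u z.1)) z.2)})].

Definition flux (phi rho : R -> V -> R) (t : R) (x : V) : V :=
  rho t x *: grad (H x) (grad (phi t) x).

Definition space_C1 (w : R -> V -> V) :=
  forall i j,
    [/\ {within (QT : set (R * V)),
          continuous (fun z : R * V => w z.1 z.2 ord0 i)},
        (forall t x, 0 < t < T ->
          derivable (fun y => w t y ord0 i) x (delta_mx ord0 j)) &
        {within (QT : set (R * V)), continuous
          (fun z : R * V => partial j (fun y => w z.1 y ord0 i) z.2)}].

Definition HJB_solution (rho : density_evolution) (phi : R -> V -> R) :=
  [/\ classical phi,
      (forall t x, 0 < t < T ->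
        - dt phi t x - nu * laplacian (phi t) x + H x (grad (phi t) x)
        = f_of rho t x) &
      (forall x, phi T x = fT_of rho x)].

Definition FP_solution (phi r : R -> V -> R) :=
  [/\ classical r,
      space_C1 (flux phi r),
      (forall t x, 0 < t < T ->
        dt r t x - nu * laplacian (r t) x - divergence (flux phi r t) x = 0) &
      (forall x, r 0 x = init M x)].

(* The regularity convention on rho: the HJB equation and the Fokker-Planck
   equation driven by its solution have unique classical solutions phi and r,
   with r > 0, and the best response is unique and equals
   (r, - r D_pH(., grad phi)). *)
Definition well_posed (rho : density_evolution) :=
  exists phi r : R -> V -> R,
    [/\ HJB_solution rho phi /\
        (forall phi', HJB_solution rho phi' ->
          forall t x, 0 <= t <= T -> phi' t x = phi t x),
        FP_solution phi r /\
        (forall r', FP_solution phi r' ->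
          forall t x, 0 <= t <= T -> r' t x = r t x),
        (forall t x, 0 <= t <= T -> 0 < r t x),
        best_response rho r (fun t x => - flux phi r t x) &
        forall r' m', best_response rho r' m' ->
          ae_eq_evolution r' r /\
          {ae muQ, forall z, QT z -> m' z.1 z.2 = - flux phi r z.1 z.2}].

Definition terminal_independent :=
  forall (mu mu' : torus_density) (x : V),
    cost_at (terminal M) mu x = cost_at (terminal M) mu' x.

End data.
End torus.

(* Main.v *)
(* Let (r_i, m_i) minimise J(.; rho^i).  Comparing each with the other,
     J(r_0, m_0; rho^0) <= J(r_1, m_1; rho^0),
     J(r_1, m_1; rho^1) <= J(r_0, m_0; rho^1),
   and adding, the dynamic costs and the terminal costs cancel, which leaves
   <r_0 - r_1, f(rho^0) - f(rho^1)> <= 0.  Let -D be this inner product.  If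
   D = 0, both inequalities are equalities, so (r_1, m_1) also minimises
   J(.; rho^0), and r_0 = r_1 by uniqueness of the best response.

   Cancelling requires finite costs.  L(x, v) >= - H(x, 0) bounds the dynamic
   cost from below.  It is not +oo: otherwise every element of C would be a
   minimiser, in particular (r_i, m_i + e) for a constant vector e, which lies
   in C because e is divergence free; this contradicts uniqueness. *)

Require Import Defs.
From mathcomp Require Import all_boot all_order all_algebra.
From mathcomp Require Import all_classical all_reals all_analysis.
From mathcomp Require Import measurable_realfun lra ring.
Import Order.TTheory GRing.Theory Num.Theory.
Import numFieldNormedType.Exports.

Local Open Scope classical_set_scope.
Local Open Scope ring_scope.

Local Notation periodic := Defs.periodic.

(** * Measurability of continuous functions on space-time *)

Section continuous_measurable.
Context {R : realType} {d : nat}.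
Notation V := 'rV[R]_d.
Notation ST := (measurableTypeR R * 'rV[R]_d)%type.

(* Rounding down to the lattice of mesh 1 / (n + 1) takes countably many values
   and tends to the identity, so f is a limit of countably-valued functions. *)
Let grid (n : nat) (z : R * V) : int * 'rV[int]_d :=
  (Num.floor (n.+1%:R * z.1), \row_i Num.floor (n.+1%:R * z.2 ord0 i)).

Let node (n : nat) (c : int * 'rV[int]_d) : R * V :=
  (n.+1%:R^-1 * c.1%:~R, \row_i (n.+1%:R^-1 * (c.2 ord0 i)%:~R)).

Let measurable_floor_fiber (g : ST -> R) n (c : int) :
  measurable_fun setT g ->
  measurable [set z | Num.floor (n.+1%:R * g z) = c].
Proof.
move=> mg; have mng : measurable_fun setT (fun z => n.+1%:R * g z).
  exact: (measurable_funM (measurable_cst _) mg).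
rewrite (_ : [set z | _] =
    setT `&` (fun z => n.+1%:R * g z) @^-1` `[c%:~R, (c + 1)%:~R[).
  exact: mng.
rewrite setTI; apply/seteqP; split => z /=; rewrite in_itv/=.
  by move=> <-; exact: floor_itv.
exact: floor_def.
Qed.

(** The index set is countable, so the preimage of an arbitrary [Y] is a countable union of cells,
    each a finite intersection of coordinate floor fibres. *)
Let measurable_grid n (Y : set (int * 'rV[int]_d)) :
  measurable ((grid n : ST -> _) @^-1` Y).
Proof.
rewrite (_ : _ @^-1` _ =
    \bigcup_(c in Y) (grid n : ST -> _) @^-1` [set c]); last first.
  by apply/seteqP; split => [z Yz|z [c Yc /= ->]//]; exists (grid n z).
rewrite bigcup_mkcond; apply: countable_bigcupT_measurable;
  first exact: countableP.
move=> [c1 c2]; case: ifPn => // _.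
rewrite (_ : _ @^-1` _ = [set z : ST | Num.floor (n.+1%:R * z.1) = c1] `&`
    \bigcap_(i in [set: 'I_d])
      [set z : ST | Num.floor (n.+1%:R * z.2 ord0 i) = c2 ord0 i]).
  apply: measurableI.
    exact: measurable_floor_fiber.
  apply: fin_bigcap_measurable => // i _.
  apply: measurable_floor_fiber.
  by apply: (@measurableT_comp _ _ _ _ _ _ (fun x : 'rV[R]_d => x ord0 i));
    [exact: measurable_rV_coord|exact: measurable_snd].
apply/seteqP; split => [z [<- <-]|z [/= <- h]].
  by split => //= i _; rewrite mxE.
by congr pair; apply/rowP => i; rewrite mxE h.
Qed.

Let cvg_node_grid (z : R * V) : node n (grid n z) @[n --> \oo] --> z.
Proof.
apply/cvg_ballP => e e0; near=> n.
have ln (a : R) : ball a e (n.+1%:R^-1 * (Num.floor (n.+1%:R * a))%:~R).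
  rewrite /ball/= ltr_norml.
  have /andP[] := floor_itv (n.+1%:R * a).
  set m := (Num.floor _)%:~R => h1; rewrite intrD1 => h2.
  have n0 : 0 < n.+1%:R :> R by [].
  have : n.+1%:R^-1 < e by near: n; exact: (near_infty_natSinv_lt (PosNum e0)).
  rewrite -(ltr_pM2l n0) mulfV// => ne.
  apply/andP; split; rewrite -(ltr_pM2l n0) mulrBr mulVKf//; nra.
by split => //=; split => // i j; rewrite mxE mxE ord1.
Unshelve. all: by end_near. Qed.

(** The sigma-algebra on [ST] is generated by the coordinates rather than by the open sets, so
    continuity alone does not give measurability at once. *)
Lemma continuous_measurable_spacetime (f : R * V -> R) :
  continuous f -> measurable_fun [set: ST] (f : ST -> R).
Proof.
move=> cf.
apply: (@measurable_fun_cvg _ _ _ _ (fun n z => f (node n (grid n z)))).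
  move=> n _ Y _; rewrite setTI.
  exact: (measurable_grid n ((f \o node n) @^-1` Y)).
by move=> z _; exact: (cvg_comp _ _ (cvg_node_grid z) (cf z)).
Qed.

End continuous_measurable.

(** * Periods and bounds of periodic functions *)

Section periodic.
Context {R : realType} {d : nat}.
Notation V := 'rV[R]_d.

(** The periods of [u] form an additive group containing the unit vectors, hence all integer
    vectors. *)
Lemma periodic_int {A : Type} {u : V -> A} (k : 'rV[int]_d) (x : V) :
  periodic u -> u (x + map_mx intr k) = u x.
Proof.
move=> pu; pose per (v : V) := forall y, u (y + v) = u y.
have perD v w : per v -> per w -> per (v + w).
  by move=> pv pw y; rewrite addrA pw pv.
have perM n v : per v -> per (v *+ n).
  move=> pv; elim: n => [|n ih]; first by move=> y; rewrite mulr0n addr0.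
  by rewrite mulrS; exact: perD.
have perN v : per v -> per (- v) by move=> pv y; rewrite -pv subrK.
suff : per (map_mx intr k) by exact.
rewrite [map_mx _ _]row_sum_delta; apply: (big_ind per) => //.
  by move=> y; rewrite addr0.
move=> i _; rewrite mxE.
have pe : per (delta_mx ord0 i) by move=> y; exact: pu.
case: (k ord0 i) => n; first by rewrite -pmulrn scaler_nat; exact: perM.
by rewrite NegzE rmorphN/= scaleNr -pmulrn scaler_nat; exact/perN/perM.
Qed.

(** Integer translations bring every point into the closed unit cube, and [[0, T]] times that cube
    is compact. *)
Lemma periodic_bounded {T : R} {u : R -> V -> R} :
  {within [set z : R * V | 0 <= z.1 <= T],
    continuous (fun z : R * V => u z.1 z.2)} ->
  (forall t, 0 <= t <= T -> periodic (u t)) ->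
  exists2 K, 0 <= K & forall t x, 0 <= t <= T -> `|u t x| <= K.
Proof.
move=> cu pu.
pose cell :=
  `[0, T]%classic `*` [set x : V | forall i, `[0, 1]%classic (x ord0 i)].
have ccell : compact cell.
  apply: compact_setX; first exact: segment_compact.
  apply: (@rV_compact _ _ (fun=> `[0 : R, 1 : R]%classic)) => _.
  exact: segment_compact.
have : {within cell, continuous (fun z : R * V => u z.1 z.2)}.
  by apply: continuous_subspaceW cu => -[t x] [/=]; rewrite in_itv.
move=> /continuous_compact/(_ ccell)/compact_bounded [K [_ bK]].
(* Compactness gives a bound by every constant strictly above [K], whence [K + 1]; the maximum with
   0 secures the sign. *)
exists (Num.max 0 (K + 1)); first by rewrite le_max lexx.
move=> t x t0T; rewrite le_max; apply/orP; right.
pose y : V := \row_i (x ord0 i - (Num.floor (x ord0 i))%:~R).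
have -> : u t x = u t y.
  rewrite -[RHS](periodic_int (\row_i Num.floor (x ord0 i)) _ (pu t t0T)).
  by congr u; apply/rowP => i; rewrite !mxE subrK.
apply: (bK (K + 1)) => //; first by rewrite ltrDl.
exists (t, y) => //; split => //= i; rewrite in_itv mxE /=.
have /andP[] := floor_itv (x ord0 i); rewrite intrD1; set m := _%:~R; lra.
Qed.
End periodic.

(** * Mean of a partial derivative over the torus *)

Section haar_partial.
Context {R : realType}.

Lemma continuous_measurable_rV {d} (w : 'rV[R]_d -> R) :
  continuous w -> measurable_fun setT w.
Proof.
move=> cw.
apply: (measurable_fun_pair2 (f := w \o snd) (0 : measurableTypeR R)).
apply: (@continuous_measurable_spacetime R d (w \o snd)) => z.
by apply: continuous_comp; [exact: cvg_snd|exact: cw].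
Qed.

Lemma rV_cons_shift {d} (h s : R) (y : 'rV[R]_d) :
  rV_cons (h + s, y) = h *: delta_mx ord0 ord0 + rV_cons (s, y).
Proof.
apply/rowP => i; rewrite !mxE /rV_cons /=; case: splitP => j ij.
  by rewrite !mxE (_ : i == ord0) ?mulr1// -val_eqE/= ij; case: j {ij} => -[].
by rewrite (_ : i == ord0 = false) ?mulr0 ?add0r// -val_eqE/= ij.
Qed.

Lemma is_derive_rV_cons {d} {w : 'rV[R]_d.+1 -> R} (s : R) (y : 'rV[R]_d) :
  derivable w (rV_cons (s, y)) (delta_mx ord0 ord0) ->
  is_derive s 1 (fun s => w (rV_cons (s, y))) (partial ord0 w (rV_cons (s, y))).
Proof.
have e :
  (fun h => h^-1 *: (((fun s => w (rV_cons (s, y))) \o shift s) (h *: 1) -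
    w (rV_cons (s, y)))) =
  (fun h => h^-1 *: ((w \o shift (rV_cons (s, y))) (h *: delta_mx ord0 ord0) -
    w (rV_cons (s, y)))).
  by apply/funext => h; rewrite /= scaler1 rV_cons_shift.
by move=> dw; split; rewrite /derivable /partial /derive e.
Qed.

Lemma continuous_rV_cons {d} (y : 'rV[R]_d) :
  continuous (fun s : R => rV_cons (s, y)).
Proof.
rewrite (_ : (fun s : R => _) =
    (fun s => s *: delta_mx ord0 ord0 + rV_cons (0, y))).
  by move=> s; apply: cvgD; [exact: (cvgZr_tmp cvg_id)|exact: cvg_cst].
by apply/funext => s; rewrite -[in LHS](addr0 s) rV_cons_shift.
Qed.

(* Adding K makes the integrand nonnegative, so that Tonelli applies. *)
Lemma haar_partial0 {d} {w : 'rV[R]_d.+1 -> R} {K : R} :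
  periodic w -> (forall x, derivable w x (delta_mx ord0 ord0)) ->
  continuous (partial ord0 w) -> (forall x, - K <= partial ord0 w x) ->
  (\int[haar R d.+1]_x (partial ord0 w x + K)%:E = K%:E)%E.
Proof.
move=> pw dw cw Kw.
have gK_ge0 x : 0 <= partial ord0 w x + K by rewrite -lerBlDr sub0r.
have mgK : measurable_fun setT
    (fun x : 'rV[R]_d.+1 => (partial ord0 w x + K)%:E).
  apply/measurable_EFinP/measurable_funD => //.
  exact: continuous_measurable_rV.
rewrite /= ge0_integral_distribution//.
(* The first coordinate is integrated innermost; each inner integral will equal [K], and [haar R d]
   has total mass one. *)
rewrite fubini_tonelli2;
  [|exact: (measurableT_comp mgK (@measurable_rV_cons R d))
   |by move=> z; rewrite lee_fin gK_ge0].
rewrite -[RHS]mule1 -[X in (_ * X)%E](@probability_setT _ _ _ (haar R d)).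
rewrite -integral_cst//.
apply: eq_integral => y _; rewrite /fubini_G.
have m2 := measurable_fun_pair1 y (@measurable_rV_cons R d).
rewrite integral_uniform;
  [|exact: (measurableT_comp mgK m2)|by move=> s; rewrite lee_fin gK_ge0].
rewrite subr0 invr1 mul1e /=.
have dF s := is_deriveD (is_derive_rV_cons s y (dw _))
  (is_deriveM (is_derive_id s 1) (is_derive_cst K s 1)).
(* The endpoints 0 and 1 of the slice differ by a unit vector, so by periodicity [w] contributes
   nothing and only the increment [K] of [s * K] remains. *)
rewrite (@continuous_FTC2 _ _ (fun s => w (rV_cons (s, y)) + s * K))//.
- rewrite mul1r mul0r addr0 -EFinB.
  rewrite -[in X in X + K](addr0 1) rV_cons_shift scale1r addrC.
  rewrite [w (_ + _)](_ : _ = w (rV_cons (0, y) + delta_mx ord0 ord0)).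
    by rewrite pw addKr.
  by congr w; rewrite addrC.
- apply: continuous_subspaceT => s; apply: (@cvgD _ R^o); last exact: cvg_cst.
  exact: (continuous_comp (continuous_rV_cons y s) (cw _)).
- have cF s : {for s, continuous (fun s => w (rV_cons (s, y)) + s * K)}.
    by apply/differentiable_continuous/derivable1_diffP; case: (dF s).
  split; first by move=> s _; case: (dF s).
    exact/cvg_at_right_filter/cF.
  exact/cvg_at_left_filter/cF.
- move=> s _; rewrite derive1E; case: (dF s) => _ ->.
  by rewrite scaler0 add0r [_%:A]mulr1.
Qed.
End haar_partial.

(** * Regularity of partial derivatives of space-time functions *)

Section slices.
Context {R : realType} {d : nat}.
Notation V := 'rV[R]_d.
Implicit Types psi : R -> V -> R.

Lemma partial_periodic {i : 'I_d} {u : V -> R} :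
  periodic u -> periodic (partial i u).
Proof.
move=> pu x j; rewrite /partial /derive.
have -> : (fun h : R =>
      h^-1 *: ((u \o shift (x + delta_mx ord0 j)) (h *: delta_mx ord0 i) -
        u (x + delta_mx ord0 j))) =
    (fun h => h^-1 *: ((u \o shift x) (h *: delta_mx ord0 i) - u x)) => //.
by apply/funext => h /=; rewrite addrA !pu.
Qed.

Let partial_quotient psi (i : 'I_d) t x :
  (fun h : R => h^-1 *: ((psi t \o shift x) (h *: delta_mx ord0 i) - psi t x)) =
  (fun h => h^-1 *: (((fun z : R * V => psi z.1 z.2) \o shift (t, x))
    (h *: ((0 : R), delta_mx ord0 i)) - psi t x)).
Proof. by apply/funext => h /=; rewrite scaler0 add0r. Qed.

(** [Ck] is stated through directional derivatives on the product; reading a spatial partial as the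
    derivative along [(0, e_i)] lets joint smoothness pass to it. *)
Lemma partialE {psi} (i : 'I_d) t x :
  partial i (psi t) x =
  'D_((0 : R), delta_mx ord0 i) (fun z : R * V => psi z.1 z.2) (t, x).
Proof. by rewrite /partial /derive partial_quotient. Qed.

Lemma derivable_slice {psi k} (i : 'I_d) t x :
  Ck k.+1 (fun z : R * V => psi z.1 z.2) ->
  derivable (psi t) x (delta_mx ord0 i).
Proof.
move=> [_ /(_ (0, delta_mx ord0 i)) [/(_ (t, x)) + _]].
by rewrite /derivable partial_quotient.
Qed.

Lemma Ck_partial {psi k} (i : 'I_d) :
  Ck k.+1 (fun z : R * V => psi z.1 z.2) ->
  Ck k (fun z : R * V => partial i (psi z.1) z.2).
Proof.
move=> [_ /(_ (0, delta_mx ord0 i)) [_]].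
by congr Ck; apply/funext => -[t x]; rewrite /= partialE.
Qed.

Lemma dtE {psi} t x :
  dt psi t x = 'D_((1 : R), (0 : V)) (fun z : R * V => psi z.1 z.2) (t, x).
Proof.
rewrite /dt derive1E /derive.
have -> : (fun h : R =>
      h^-1 *: (((fun s => psi s x) \o shift t) (h *: 1) - psi t x)) =
    (fun h => h^-1 *: (((fun z : R * V => psi z.1 z.2) \o shift (t, x))
      (h *: ((1 : R), (0 : V))) - psi t x)) => //.
by apply/funext => h /=; rewrite scaler0 add0r.
Qed.

Lemma Ck_dt {psi k} :
  Ck k.+1 (fun z : R * V => psi z.1 z.2) ->
  Ck k (fun z : R * V => dt psi z.1 z.2).
Proof.
move=> [_ /(_ (1, 0)) [_]].
by congr Ck; apply/funext => -[t x]; rewrite /= dtE.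
Qed.

Lemma Ck_continuous {k} {E : normedModType R} {f : E -> R} :
  Ck k f -> continuous f.
Proof. by case: k => [|k] []. Qed.

End slices.

(** * The space-time cylinder: measure and integrability of densities *)

Section QT_lemmas.
Context {R : realType} {d : nat} (M : mfg_data R d).
Notation V := 'rV[R]_d.
Notation ST := (measurableTypeR R * 'rV[R]_d)%type.
Notation T := (horizon M).
Notation mu := (@lebesgue_measure R \x haar R d)%E.

Lemma QTE : QT M = `]0, T[%classic `*` setT.
Proof. by apply/seteqP; split => -[t x]; rewrite /QT/= in_itv/= => // -[]. Qed.

Lemma QT_closureE : QT_closure M = `[0, T]%classic `*` setT.
Proof.
by apply/seteqP; split => -[t x]; rewrite /QT_closure/= in_itv/= => // -[].
Qed.

Lemma measurable_QT : measurable (QT M).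
Proof. by rewrite QTE; exact: measurableX. Qed.

Lemma measurable_QT_closure : measurable (QT_closure M).
Proof. by rewrite QT_closureE; exact: measurableX. Qed.

Lemma QT_sub_closure : QT M `<=` QT_closure M.
Proof. by move=> z /andP[/ltW z0 /ltW zT]; apply/andP. Qed.

Lemma measure_QT : 0 <= T -> mu (QT M) = T%:E.
Proof.
move=> T0; rewrite QTE product_measure1E//.
rewrite [X in (_ * X)%E](@probability_setT _ _ _ (haar R d)) mule1.
by rewrite /= lebesgue_measure_itv/= lte_fin sube0; case: ltgtP T0 => // <-.
Qed.

(** By Tonelli: every slice at a time in []0, T[] has mass one, so the total mass is the length of
    the interval. *)
Lemma integrable_density {rho : R -> V -> R} : 0 <= T ->
  (forall t, 0 <= t <= T -> is_density (rho t)) ->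
  measurable_fun (QT_closure M) (fun z : ST => rho z.1 z.2) ->
  mu.-integrable (QT M) (fun z : ST => (rho z.1 z.2)%:E).
Proof.
move=> T0 drho mrho.
have mrhoQ : measurable_fun (QT M) (fun z : ST => (rho z.1 z.2)%:E).
  apply/measurable_EFinP; apply: measurable_funS mrho;
    last exact: QT_sub_closure.
  exact: measurable_QT_closure.
apply/integrableP; split => //.
rewrite integral_mkcond fubini_tonelli1/=; first last.
- by move=> z; rewrite /patch; case: ifP => _; rewrite ?lee_fin.
- apply/(measurable_restrictT _ measurable_QT).
  exact: (@measurableT_comp _ _ _ _ _ _ abse _ _ _ mrhoQ).
suff -> : fubini_F (haar R d) ((fun z : ST => `|rho z.1 z.2|%:E) \_ (QT M)) =
    cst 1%E \_ `]0, T[%classic.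
  rewrite -integral_mkcond integral_cst//= mul1e lebesgue_measure_itv/=.
  by case: ifP => _; rewrite ?ltry// -EFinB ltry.
apply/funext => t; rewrite /fubini_F /patch.
have Qt x : ((t, x) \in QT M) = (t \in `]0, T[%classic).
  by rewrite QTE; apply/idP/idP => /set_mem tQ; apply/mem_set => //; case: tQ.
under eq_integral do rewrite Qt.
case: ifPn => [|_]; last by rewrite integral0.
rewrite inE/= in_itv/= => /andP[t0 tT].
have [|_ _ r0 <-] := drho t; first by rewrite !ltW.
by apply: eq_integral => x _; rewrite ger0_norm.
Qed.

End QT_lemmas.

(** * Integrability of the weak continuity equation *)

Section perturbation.
Context {R : realType}.

Lemma bounded_mul_integrable {disp} {X : measurableType disp}
    {mu : {measure set X -> \bar R}} {D : set X} (f g : X -> R) (K : R) :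
  measurable D -> measurable_fun D f -> (forall x, D x -> `|f x| <= K) ->
  mu.-integrable D (EFin \o g) ->
  mu.-integrable D (EFin \o (fun x => f x * g x)).
Proof.
move=> mD mf fK ig.
have mg : measurable_fun D g.
  by apply/measurable_EFinP; exact: measurable_int ig.
apply: (le_integrable mD _ _ (integrableZl mD K ig)).
  by apply/measurable_EFinP; exact: measurable_funM.
move=> x Dx; rewrite /= lee_fin !normrM ler_wpM2r//.
exact: le_trans (fK x Dx) (ler_norm K).
Qed.

Section test_function.
Context {d : nat} {M : mfg_data R d}.
Notation V := 'rV[R]_d.
Notation ST := (measurableTypeR R * 'rV[R]_d)%type.

Lemma continuous_measurable_bounded {g : R -> V -> R} :
  continuous (fun z : R * V => g z.1 z.2) -> (forall t, periodic (g t)) ->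
  measurable_fun (QT M) (fun z : ST => g z.1 z.2) /\
  exists2 K, 0 <= K & forall z, QT M z -> `|g z.1 z.2| <= K.
Proof.
move=> cg pg; split.
  by apply: measurable_funTS; exact: continuous_measurable_spacetime cg.
have [K K0 gK] : exists2 K, 0 <= K &
    forall t x, 0 <= t <= horizon M -> `|g t x| <= K.
  by apply: periodic_bounded => [|t _]; [exact: continuous_subspaceT|exact: pg].
by exists K => // z /QT_sub_closure; exact: gK.
Qed.

(** Derivatives of [psi] are continuous and periodic, hence bounded, while [rho] and the components
    of [m] are integrable. This permits splitting the weak equation additively when [m] is
    perturbed. *)
Lemma test_integrand_integrable {rho m psi} : 0 < horizon M ->
  constraint_set M rho m -> test_function M psi ->
  (@lebesgue_measure R \x haar R d)%E.-integrable (QT M) (EFin \o (fun z : ST =>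
    rho z.1 z.2 * (dt psi z.1 z.2 + viscosity M * laplacian (psi z.1) z.2)
       + dot (m z.1 z.2) (grad (psi z.1) z.2))).
Proof.
move=> T0 [[drho mrho _] [_ im] _ _] [smooth per _].
have mQ := measurable_QT M.
have irho := integrable_density M (ltW T0) drho mrho.
have cpart i : continuous (fun z : R * V => partial i (psi z.1) z.2).
  exact: Ck_continuous (Ck_partial i (smooth 1%N)).
have cpp i : continuous (fun z : R * V => partial i (partial i (psi z.1)) z.2).
  apply: Ck_continuous (Ck_partial (psi := fun t => partial i (psi t)) i _).
  exact: Ck_partial (smooth 2%N).
have clap : continuous (fun z : R * V => laplacian (psi z.1) z.2).
  by apply: continuous_big => [|i _]; [exact: add_continuous|exact: cpp].
have cdt : continuous (fun z : R * V => dt psi z.1 z.2).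
  exact: Ck_continuous (Ck_dt (smooth 1%N)).
have pdt t : periodic (dt psi t).
  move=> x i; rewrite /dt; congr (_^`()%classic t).
  by apply/funext => s; exact: per.
have plap t : periodic (laplacian (psi t)).
  move=> x i; apply: eq_bigr => j _.
  exact/partial_periodic/partial_periodic.
pose mu := (@lebesgue_measure R \x haar R d)%E.
have iA : mu.-integrable (QT M) (EFin \o (fun z : ST =>
    rho z.1 z.2 * (dt psi z.1 z.2 + viscosity M * laplacian (psi z.1) z.2))).
  have cL : continuous (fun z : R * V =>
      dt psi z.1 z.2 + viscosity M * laplacian (psi z.1) z.2).
    move=> z; apply: cvgD; first exact: cdt.
    by apply: cvgMl_tmp; exact: clap.
  have [|mL [K _ LK]] := @continuous_measurable_bounded
     (fun t x => dt psi t x + viscosity M * laplacian (psi t) x) cL.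
    by move=> t x i; rewrite pdt plap.
  have := bounded_mul_integrable _ _ _ mQ mL LK irho.
  by apply: eq_integrable => // z _; rewrite /= mulrC.
have iB : mu.-integrable (QT M) (EFin \o (fun z : ST =>
    dot (m z.1 z.2) (grad (psi z.1) z.2))); last first.
  by have := integrableD mQ iA iB; apply: eq_integrable mQ _ _ _ => z _.
rewrite (_ : _ \o _ = fun z : ST =>
    (\sum_(i < d) (m z.1 z.2 ord0 i * partial i (psi z.1) z.2)%:E)%E).
  apply: integrable_sum => // i _.
  have [mp [K _ pK]] := continuous_measurable_bounded (cpart i)
    (fun t => partial_periodic (per t)).
  have := bounded_mul_integrable _ _ _ mQ mp pK (im i).
  by apply: eq_integrable => // z _; rewrite /= mulrC.
apply/funext => z; rewrite sumEFin; congr EFin.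
by apply: eq_bigr => i _; rewrite mxE.
Qed.
End test_function.
End perturbation.

Lemma bounded_integrable_QT {R : realType} {d : nat} {M : mfg_data R d}
    {f : measurableTypeR R * 'rV[R]_d -> R} {K : R} : 0 <= horizon M ->
  measurable_fun (QT M) f -> (forall z, QT M z -> `|f z| <= K) ->
  (@lebesgue_measure R \x haar R d)%E.-integrable (QT M) (EFin \o f).
Proof.
move=> T0 mf fK; apply: measurable_bounded_integrable => //.
- exact: measurable_QT.
- by rewrite [X in (X < _)%E](measure_QT M T0) ltry.
exists K; split; first exact: num_real.
by move=> y Ky z Qz; apply: le_trans (ltW Ky); exact: fK.
Qed.

Lemma integrable_cst_QT {R : realType} {d : nat} {M : mfg_data R d} (c : R) :
  0 <= horizon M ->
  (@lebesgue_measure R \x haar R d)%E.-integrable (QT M) (EFin \o (fun=> c)).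
Proof. by move=> T0; exact: (bounded_integrable_QT (K := `|c|)). Qed.

(** * Adding a constant vector to the flux, in positive dimension *)

Section drift_perturbation.
Context {R : realType} {d : nat} {M : mfg_data R d.+1}.
Notation V := 'rV[R]_d.+1.
Notation ST := (measurableTypeR R * 'rV[R]_d.+1)%type.
Notation mu := (@lebesgue_measure R \x haar R d.+1)%E.
Notation T := (horizon M).

(** On each time slice the derivative of a periodic function has zero mean. *)
Lemma integral_partial0_test {psi} : 0 < T -> test_function M psi ->
  mu.-integrable (QT M) (EFin \o (fun z : ST => partial ord0 (psi z.1) z.2)) /\
  \int[mu]_(z in QT M) partial ord0 (psi z.1) z.2 = 0.
Proof.
move=> T0 [smooth per _].
have mQ := measurable_QT M.
have cg : continuous (fun z : R * V => partial ord0 (psi z.1) z.2).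
  exact: Ck_continuous (Ck_partial ord0 (smooth 1%N)).
have [mg [K K0 gK]] := continuous_measurable_bounded (M := M) cg
  (fun t => partial_periodic (per t)).
have ig := bounded_integrable_QT (ltW T0) mg gK.
have iK := integrable_cst_QT (M := M) K (ltW T0).
have gK_ge0 z : QT M z -> 0 <= partial ord0 (psi z.1) z.2 + K.
  by move=> /gK; rewrite ler_norml => /andP[]; rewrite -lerBlDr sub0r.
(* Shifting by the bound [K] makes the integrand nonnegative, so Tonelli reduces the claim to
   [haar_partial0] on slices. *)
split=> //; suff : \int[mu]_(z in QT M) (partial ord0 (psi z.1) z.2 + K) =
       \int[mu]_(z in QT M) K.
  by rewrite RintegralD// => /(canRL (addrK _)); rewrite subrr.
rewrite /Rintegral integral_cst// [X in (_ * X)%E](measure_QT M (ltW T0)).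
congr fine.
rewrite integral_mkcond fubini_tonelli1/=; first last.
- move=> z; rewrite /patch; case: ifPn => // /set_mem Qz.
  by rewrite lee_fin gK_ge0.
- apply/(measurable_restrictT _ mQ).
  by apply/measurable_EFinP/measurable_funD.
transitivity (\int[lebesgue_measure]_t ((cst K%:E \_ `]0%R, T[%classic) t))%E;
  last first.
  rewrite -integral_mkcond integral_cst//= lebesgue_measure_itv/= lte_fin T0.
  by rewrite sube0.
apply: eq_integral => t _; rewrite /fubini_F /patch.
have Qt x : ((t, x) \in QT M) = (t \in `]0, T[%classic).
  by rewrite QTE; apply/idP/idP => /set_mem tQ; apply/mem_set => //; case: tQ.
under eq_integral do rewrite Qt.
case: ifPn => [t0T|_]; last by rewrite integral0.
apply: haar_partial0 => [|x|x|x].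
- exact: per.
- exact: (derivable_slice (psi := psi) ord0 t x (smooth 1%N)).
- apply: (continuous_comp (f := fun x => (t, x))
    (g := fun z : R * V => partial ord0 (psi z.1) z.2)).
    by apply: (@cvg_pair _ _ _ (nbhs x) (nbhs t) (nbhs x) _ _ _ (fun=> t) id);
      [exact: cvg_cst|exact: cvg_id].
  exact: cg.
- have /gK/= : QT M (t, x) by apply/set_mem; rewrite Qt.
  by rewrite ler_norml => /andP[].
Qed.

(** A constant field is divergence free: the weak equation gains only the integral of [partial ord0]
    of the test function, which vanishes. *)
Lemma constraint_set_add_delta {rho m} : 0 < T -> constraint_set M rho m ->
  constraint_set M rho (fun t x => m t x + delta_mx ord0 ord0).
Proof.
move=> T0 Cm; have [crho [pm im] rho0 cont] := Cm.
have mQ := measurable_QT M.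
split => //; first split.
- by move=> t tT x i; rewrite pm.
- move=> i.
  have := integrableD mQ (im i)
    (integrable_cst_QT (M := M) ((delta_mx ord0 ord0 : V) ord0 i) (ltW T0)).
  by apply: eq_integrable mQ _ _ _ => z _; rewrite !mxE.
move=> psi tpsi.
have iold := test_integrand_integrable T0 Cm tpsi.
have [ipart part0] := integral_partial0_test T0 tpsi.
rewrite -[RHS](cont psi tpsi) -[RHS]addr0 -part0 -(RintegralD mQ iold ipart).
apply: eq_Rintegral => z _; rewrite -addrA; congr (_ + _).
rewrite /dot; under eq_bigr do rewrite mxE mulrDl.
rewrite big_split/=; congr (_ + _).
rewrite (bigD1 ord0)//= !mxE eqxx mul1r big1 ?addr0//.
by move=> i /negbTE i0; rewrite !mxE i0 andbF mul0r.
Qed.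
End drift_perturbation.

(** * Finiteness of lower integrals *)

(* The running cost is not known to be measurable.  On nonnegative functions
   the library integral is the lower integral, hence monotone without
   measurability. *)
Section lower_integral.
Local Open Scope ereal_scope.
Context {disp} {X : measurableType disp} {R : realType}.
Context {mu : {measure set X -> \bar R}} {D : set X}.

Lemma ge0_le_lower_integral {f g : X -> \bar R} :
  (forall x, D x -> 0 <= f x) -> (forall x, D x -> f x <= g x) ->
  \int[mu]_(x in D) f x <= \int[mu]_(x in D) g x.
Proof.
move=> f0 fg; rewrite !ge0_integralE//; last first.
  by move=> x Dx; exact: le_trans (f0 x Dx) (fg x Dx).
apply: le_ereal_sup => _ [h hf <-]; exists h => // x.
apply: le_trans (hf x) _; rewrite /patch; case: ifPn => // /set_mem; exact: fg.
Qed.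

(** [integralE] splits the integral into positive and negative parts by definition; the negative
    part is dominated by [g]. *)
Lemma lower_integral_gtNy {f g : X -> \bar R} :
  (forall x, D x -> 0 <= g x) -> (forall x, D x -> - g x <= f x) ->
  \int[mu]_(x in D) g x < +oo -> -oo < \int[mu]_(x in D) f x.
Proof.
move=> g0 gf goo; rewrite integralE.
have fn : \int[mu]_(x in D) f^\- x < +oo.
  apply: le_lt_trans goo; apply: ge0_le_lower_integral => x Dx.
    exact: funeneg_ge0.
  by rewrite funenegE ge_max g0// leeNl gf.
have fn0 : 0 <= \int[mu]_(x in D) f^\- x.
  by apply: integral_ge0 => x _; exact: funeneg_ge0.
have fp0 : 0 <= \int[mu]_(x in D) f^\+ x.
  by apply: integral_ge0 => x _; exact: funepos_ge0.
apply: lt_le_trans (leeDr _ fp0).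
by rewrite lteNr.
Qed.

Lemma lower_integral_fin_num {f g : X -> \bar R} :
  (forall x, D x -> `|f x| <= g x) ->
  \int[mu]_(x in D) g x < +oo -> \int[mu]_(x in D) f x \is a fin_num.
Proof.
move=> fg goo.
have g0 x : D x -> 0 <= g x by move=> /fg; exact: le_trans.
rewrite fin_numE; apply/andP; split.
  rewrite -ltNye; apply: lower_integral_gtNy goo => // x Dx.
  by rewrite leeNl; apply: le_trans (fg x Dx); rewrite -abseN lee_abs.
rewrite -ltey integralE.
apply: (@le_lt_trans _ _ (\int[mu]_(x in D) f^\+ x)).
  rewrite -[leRHS]adde0 leeD2l// leeNl oppe0.
  by apply: integral_ge0 => x _; exact: funeneg_ge0.
apply: le_lt_trans goo; apply: ge0_le_lower_integral => x Dx.
  exact: funepos_ge0.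
rewrite funeposE ge_max g0// andbT.
by apply: le_trans (fg x Dx); exact: lee_abs.
Qed.

End lower_integral.

(** * From null sets at each time to a null set in space-time *)

Section null_sets.
Context {R : realType} {d : nat} {M : mfg_data R d}.
Notation ST := (measurableTypeR R * 'rV[R]_d)%type.
Notation mu := (@lebesgue_measure R \x haar R d)%E.

(** The exceptional sets given at each time need not fit together measurably. The disagreement set
    [N] is measurable because [u] and [v] are, and its time slices are null, so its product measure
    is zero. *)
Lemma ae_eq_evolution_QT {u v : R -> 'rV[R]_d -> R} :
  measurable_fun (QT M) (fun z : ST => u z.1 z.2) ->
  measurable_fun (QT M) (fun z : ST => v z.1 z.2) ->
  ae_eq_evolution M u v ->
  exists N, [/\ measurable N, mu N = 0%E &
    forall z, QT M z -> ~ N z -> u z.1 z.2 = v z.1 z.2].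
Proof.
move=> mu' mv uv.
pose N : set ST :=
  QT M `&` (fun z : ST => u z.1 z.2 - v z.1 z.2) @^-1` (~` [set 0]).
have mN : measurable N.
  apply: (measurable_funB mu' mv) => //; first exact: measurable_QT.
  by apply: measurableC; exact: measurable_set1.
exists N; split => //; last first.
  move=> z Qz Nz; apply/eqP; rewrite -subr_eq0; apply/eqP.
  by apply: contrapT => uvz; apply: Nz; split.
apply: integral0_eq => t _ /=.
have [t0T|nt0T] := boolP (0 < t < horizon M).
  have t0T' : 0 <= t <= horizon M by case/andP: t0T => /ltW-> /ltW->.
  have [B [mB B0 BN]] := uv t t0T'.
  apply: subset_measure0 B0 => //; first exact: measurable_xsection.
  move=> x /xsectionP -[_ /= uvx]; apply: BN => /= uvE.
  by apply: uvx; rewrite uvE subrr.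
rewrite (_ : xsection N t = set0) ?measure0//.
apply/seteqP; split => // x /xsectionP -[]; rewrite /QT/= => t0T.
by rewrite t0T in nt0T.
Qed.

End null_sets.

(** * Bounds for the dynamic, terminal and interaction costs *)

Section costs.
Context {R : realType} {d : nat} {M : mfg_data R d}
  (hM : standing_assumptions M).
Notation V := 'rV[R]_d.
Notation ST := (measurableTypeR R * 'rV[R]_d)%type.
Notation mu := (@lebesgue_measure R \x haar R d)%E.
Notation T := (horizon M).
Notation H := (hamiltonian M).

Let T_gt0 : 0 < T. Proof. by case: hM. Qed.
Let T_in : 0 <= T <= T. Proof. by rewrite lexx ltW. Qed.

(** Take [p = 0] in the supremum defining [lagrangian]; for [r = 0] the running cost is 0 or
    infinite. *)
Lemma running_cost_ge (x m : V) (r : R) : 0 <= r ->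
  (- (r * H x 0)%:E <= running_cost M x r m)%E.
Proof.
move=> r0; rewrite /running_cost; case: eqP => [->|_].
  by rewrite mul0r oppe0; case: ifP.
rewrite -EFinN -mulrN EFinM lee_wpmul2l ?lee_fin//.
apply: ereal_sup_ubound; exists 0 => //=.
by rewrite /dot big1 ?oppr0 ?sub0r// => i _; rewrite mxE mul0r.
Qed.

Lemma constraint_set_measurable {rho m} : constraint_set M rho m ->
  measurable_fun (QT M) (fun z : ST => rho z.1 z.2).
Proof.
move=> [[_ mrho _] _ _ _].
apply: measurable_funS mrho; last exact: QT_sub_closure.
exact: measurable_QT_closure.
Qed.

(** [H x 0] is bounded by some [K] on the torus, so the running cost is at least [- K * rho], which
    is integrable. *)
Lemma dynamic_cost_gtNy {rho m} : constraint_set M rho m ->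
  (-oo < dynamic_cost M rho m)%E.
Proof.
move=> [[drho mrho _] _ _ _].
have [_ _ _ [pH H2 _ _ _] _] := hM.
have [K K0 HK] : exists2 K, 0 <= K & forall t x, 0 <= t <= T -> `|H x 0| <= K.
  apply: periodic_bounded => [|t _]; last exact: pH.
  apply: continuous_subspaceT => z.
  apply: (continuous_comp (f := snd) (g := fun x => H x 0)).
    exact: cvg_snd.
  exact: Ck_continuous (H2 0) _.
have irho := integrable_density M (ltW T_gt0) drho mrho.
have rho_ge0 z : QT M z -> 0 <= rho z.1 z.2.
  by move=> /QT_sub_closure /drho[].
apply: (lower_integral_gtNy (g := fun z : ST => (K%:E * (rho z.1 z.2)%:E)%E)).
- by move=> z Qz; rewrite mule_ge0 ?lee_fin// rho_ge0.
- move=> z Qz /=.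
  apply: le_trans (running_cost_ge z.2 (m z.1 z.2) _ (rho_ge0 z Qz)).
  rewrite -EFinN lee_fin lerN2 mulrC ler_wpM2r ?rho_ge0//.
  exact: le_trans (ler_norm _) (HK _ _ T_in).
rewrite integralZl//; last exact: measurable_QT.
by rewrite ltey_eq fin_numM// integrable_fin_num//; exact: measurable_QT.
Qed.

(** The terminal cost is bounded since it is the value at time [T] of the classical HJB solution
    from [well_posed], which is continuous up to [T] and periodic. *)
Lemma terminal_cost_fin_num {rho r} : well_posed M rho -> is_density r ->
  (\int[haar R d]_x (fT_of M rho x * r x)%:E)%E \is a fin_num.
Proof.
move=> [phi [_ [[[[pphi cphi _ _ _] _ phiT] _] _ _ _ _]]] [_ mr r0 r1].
have [K K0 phiK] := periodic_bounded cphi pphi.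
apply: (lower_integral_fin_num (g := fun x => (K%:E * (r x)%:E)%E)).
  move=> x _; rewrite -EFinM /= lee_fin normrM (ger0_norm (r0 x)) ler_wpM2r//.
  by rewrite -phiT phiK.
by rewrite ge0_integralZl ?lee_fin ?r1 ?mule1 ?ltry//;
  [exact/measurable_EFinP|move=> x _; rewrite lee_fin].
Qed.

(* By uniqueness rhat coincides a.e. with a continuous function on [0, T] x T^d,
   hence with its own truncation. *)
Lemma best_response_ae_bounded {rho rhat mhat} : well_posed M rho ->
  best_response M rho rhat mhat ->
  exists K N, [/\ measurable N, mu N = 0%E &
    forall z, QT M z -> ~ N z -> `|rhat z.1 z.2| <= K].
Proof.
move=> [phi [r [_ [[[pr cr _ _ _] _ _ _] _] _ _ uniq]]] br.
have [/uniq[rhatE _] Chat] := (br, br.1).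
have [K K0 rK] := periodic_bounded cr pr.
have mrhat := constraint_set_measurable Chat.
(* Comparing [rhat] with its truncation at [K], rather than with [r], requires only the
   measurability of [rhat]. *)
have [||N [mN N0 NE]] :=
    @ae_eq_evolution_QT _ _ M rhat (fun t x => Num.min (rhat t x) K) mrhat.
- by apply: measurable_minr => //; exact: measurable_cst.
- move=> t tT; apply: filterS (rhatE t tT) => x ->.
  by apply/esym/min_idPl; exact: le_trans (ler_norm _) (rK t x tT).
exists K, N; split => // z Qz Nz.
have [[drhat _ _] _ _ _] := Chat.
have [_ _ rhat0 _] := drhat _ (QT_sub_closure M z Qz).
by rewrite ger0_norm// (NE z Qz Nz) ge_min lexx orbT.
Qed.

Lemma ae_bounded_mul_integrable {f g : ST -> R} {K N} :
  measurable N -> mu N = 0%E ->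
  measurable_fun (QT M) g -> (forall z, QT M z -> ~ N z -> `|g z| <= K) ->
  mu.-integrable (QT M) (EFin \o f) ->
  mu.-integrable (QT M) (EFin \o (fun z => f z * g z)).
Proof.
move=> mN N0 mg gK iF; have mQ := measurable_QT M.
have mf : measurable_fun (QT M) f.
  by apply/measurable_EFinP; exact: measurable_int iF.
apply/(negligible_integrable mN mQ _ N0).
  by apply/measurable_EFinP; exact: measurable_funM.
have mQN : measurable (QT M `\` N) by exact: measurableD.
have subQ : QT M `\` N `<=` QT M by move=> z [].
have := bounded_mul_integrable g f K mQN (measurable_funS mQ subQ mg) _
  (integrableS mQ mQN subQ iF).
move=> /(_ (fun z (QNz : (QT M `\` N) z) => gK z QNz.1 QNz.2)).
by apply: eq_integrable => // z _ /=; rewrite mulrC.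
Qed.

(** The bound [|a| <= a ^+ 2 + 1] suffices on a set of finite measure. *)
Lemma square_integrable_integrable {f} : square_integrable_QT M f ->
  mu.-integrable (QT M) (EFin \o (fun z : ST => f z.1 z.2)).
Proof.
move=> [mf if2]; have mQ := measurable_QT M.
apply: (le_integrable mQ _ _
  (integrableD mQ if2 (integrable_cst_QT 1 (ltW T_gt0)))).
  exact/measurable_EFinP.
move=> z _; rewrite /= lee_fin; set a := f _ _.
rewrite [leRHS]ger0_norm ?addr_ge0 ?sqr_ge0//.
rewrite -real_normK ?num_real//; have := normr_ge0 a; set b := `|a|; nra.
Qed.

End costs.

(** * Finite cost of best responses *)

Lemma J_lt_pinfty {R : realType} {d : nat} {M : mfg_data R d.+1}
    {rho rhat mhat} :
  0 < horizon M -> well_posed M rho -> best_response M rho rhat mhat ->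
  (J M rhat mhat rho < +oo)%E.
Proof.
move=> T0 [phi [r [_ _ _ _ uniq]]] br; rewrite ltey; apply/eqP => Joo.
pose m' t x := mhat t x + delta_mx ord0 ord0.
(* If the minimum is infinite, so is the cost of every competitor, and the perturbed pair is a
   minimiser too. *)
have br' : best_response M rho rhat m'.
  split; first exact: constraint_set_add_delta T0 br.1.
  by move=> s n /br.2; rewrite Joo leye_eq => /eqP ->; exact: leey.
have [_ mE] := uniq _ _ br; have [_ m'E] := uniq _ _ br'.
pose mu := (@lebesgue_measure R \x haar R d.+1)%E.
(* Uniqueness gives [mhat = m'] almost everywhere on [QT M], which at coordinate [ord0] reads
   [1 = 0]; hence [QT M] would be null, against its measure [T > 0]. *)
have [B [mB B0 QB]] : {ae mu, forall z, ~ QT M z}.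
  apply: filterS2 mE m'E => z mz m'z Qz.
  have := m'z Qz; rewrite /m' (mz Qz) => /eqP.
  rewrite -subr_eq0 addrAC subrr add0r => /eqP/matrixP/(_ ord0 ord0).
  by rewrite !mxE !eqxx => /eqP; rewrite oner_eq0.
have : mu (QT M) = 0%E.
  apply: subset_measure0 B0 => //; first exact: measurable_QT.
  by move=> z Qz; apply: QB => /=; apply.
rewrite [LHS](measure_QT M (ltW T0)) => -[T00].
by rewrite T00 ltxx in T0.
Qed.

(** The interaction and terminal terms are finite, so finiteness of [J] from above passes to the
    dynamic cost. *)
Lemma dynamic_cost_fin_num {R : realType} {d : nat} {M : mfg_data R d.+1}
    {rho rhat mhat} :
  standing_assumptions M -> well_posed M rho ->
  (\int[@muQ R d.+1]_(z in QT M) (f_of M rho z.1 z.2 * rhat z.1 z.2)%:E)%E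
    \is a fin_num ->
  best_response M rho rhat mhat ->
  dynamic_cost M rhat mhat \is a fin_num.
Proof.
move=> hM wp Ffin br; have T0 : 0 < horizon M by case: hM.
have drhat : is_density (rhat (horizon M)).
  by have [[[drhat _ _] _ _ _] _] := br; apply: drhat; rewrite lexx ltW.
have Gfin := terminal_cost_fin_num hM wp drhat.
have := J_lt_pinfty T0 wp br; rewrite /J.
have := dynamic_cost_gtNy hM br.1.
by rewrite fin_numE -(fineK Ffin) -(fineK Gfin); case: (dynamic_cost _ _ _).
Qed.

(** [haar R 0] is the Dirac mass at the only point, so integrating is evaluating. *)
Lemma density_rV0 {R : realType} {u : 'rV[R]_0 -> R} x :
  is_density u -> u x = 1.
Proof.
move=> [_ mu _]; rewrite /= integral_dirac//; last exact/measurable_EFinP.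
rewrite diracT mul1e => -[<-]; congr u; exact: thinmx0.
Qed.

(** * Optimality inequalities and the sign of [D] *)

Theorem proposition3p11 (R : realType) (d : nat) (M : mfg_data R d)
    (hM : standing_assumptions M)
    (rho0 rho1 : density_evolution R d)
    (wp0 : well_posed M rho0) (wp1 : well_posed M rho1)
    (f0_L2 : square_integrable_QT M (f_of M rho0))
    (f1_L2 : square_integrable_QT M (f_of M rho1))
    (rhohat0 rhohat1 : R -> 'rV[R]_d -> R)
    (mhat0 mhat1 : R -> 'rV[R]_d -> 'rV[R]_d)
    (br0 : best_response M rho0 rhohat0 mhat0)
    (br1 : best_response M rho1 rhohat1 mhat1)
    (fT_indep : terminal_independent M) :
  exists D : R,
    [/\ inner_QT M (fun t x => rhohat0 t x - rhohat1 t x)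
                   (fun t x => f_of M rho0 t x - f_of M rho1 t x) + D = 0,
        0 <= D &
        D = 0 <-> ae_eq_evolution M rhohat0 rhohat1].
Proof.
have T0 : 0 < horizon M by case: hM.
have TT : 0 <= horizon M <= horizon M by rewrite lexx ltW.
have [[drho0 _ _] _ _ _] := br0.1; have [[drho1 _ _] _ _ _] := br1.1.
case: d => [|d] in M hM rho0 rho1 wp0 wp1 f0_L2 f1_L2 rhohat0 rhohat1 mhat0
  mhat1 br0 br1 fT_indep T0 TT drho0 drho1 *.
  (* On the point R^0 every density is 1, and there is no direction in which to
     perturb m. *)
  exists 0; split => //.
    rewrite addr0 /inner_QT (@eq_Rintegral _ _ _ _ _ (fun=> 0)).
      rewrite Rintegral_cst ?mul0r//.
      exact: measurable_QT.
    move=> z zQ; have Qz := QT_sub_closure M z (set_mem zQ).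
    rewrite !(density_rV0 _ (drho0 _ Qz), density_rV0 _ (drho1 _ Qz)).
    by rewrite subrr mul0r.
  split=> // _ t tT; apply: aeW => x.
  by rewrite (density_rV0 _ (drho0 _ tT)) (density_rV0 _ (drho1 _ tT)).
pose mu := (@lebesgue_measure R \x haar R d.+1)%E.
pose f0 (z : measurableTypeR R * 'rV[R]_d.+1) := f_of M rho0 z.1 z.2.
pose f1 (z : measurableTypeR R * 'rV[R]_d.+1) := f_of M rho1 z.1 z.2.
pose r0 (z : measurableTypeR R * 'rV[R]_d.+1) := rhohat0 z.1 z.2.
pose r1 (z : measurableTypeR R * 'rV[R]_d.+1) := rhohat1 z.1 z.2.
have mQ := measurable_QT M.
have mr0 := constraint_set_measurable br0.1.
have mr1 := constraint_set_measurable br1.1.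
have if0 : mu.-integrable (QT M) (EFin \o f0) :=
  square_integrable_integrable hM f0_L2.
have if1 : mu.-integrable (QT M) (EFin \o f1) :=
  square_integrable_integrable hM f1_L2.
have [K0 [N0 [mN0 N00 bd0]]] := best_response_ae_bounded wp0 br0.
have [K1 [N1 [mN1 N10 bd1]]] := best_response_ae_bounded wp1 br1.
(* In [i01], [g01], [J01] and their likes, the first index is that of the given evolution and the
   second that of the best response. *)
have i00 := ae_bounded_mul_integrable mN0 N00 mr0 bd0 if0.
have i01 := ae_bounded_mul_integrable mN1 N10 mr1 bd1 if0.
have i10 := ae_bounded_mul_integrable mN0 N00 mr0 bd0 if1.
have i11 := ae_bounded_mul_integrable mN1 N10 mr1 bd1 if1.
have realE (x : \bar R) : x \is a fin_num -> exists a, a%:E = x.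
  by move=> /fineK <-; exists (fine x).
have [R0 R0E] :=
  realE _ (dynamic_cost_fin_num hM wp0 (integrable_fin_num mQ i00) br0).
have [R1 R1E] :=
  realE _ (dynamic_cost_fin_num hM wp1 (integrable_fin_num mQ i11) br1).
have [G0 G0E] := realE _ (terminal_cost_fin_num hM wp0 (drho0 _ TT)).
have [G1 G1E] := realE _ (terminal_cost_fin_num hM wp0 (drho1 _ TT)).
(* This is where independence of the terminal cost enters: [G0] and [G1] serve against both [rho0]
   and [rho1], and so cancel. *)
have fTE : fT_of M rho1 = fT_of M rho0 by apply/funext => x; exact: fT_indep.
have JE rho rhat mhat a b :
    mu.-integrable (QT M)
      (EFin \o (fun z => f_of M rho z.1 z.2 * rhat z.1 z.2)) ->
    a%:E = dynamic_cost M rhat mhat ->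
    b%:E = (\int[haar R d.+1]_x (fT_of M rho x * rhat (horizon M) x)%:E)%E ->
    J M rhat mhat rho =
      (a + \int[mu]_(z in QT M) (f_of M rho z.1 z.2 * rhat z.1 z.2) + b)%:E.
  move=> iF aE bE; rewrite /J -aE -bE !EFinD /Rintegral fineK//.
  exact: integrable_fin_num.
have J00 := JE _ _ _ _ _ i00 R0E G0E; have J01 := JE _ _ _ _ _ i01 R1E G1E.
rewrite -fTE in G0E G1E.
have J10 := JE _ _ _ _ _ i10 R0E G0E; have J11 := JE _ _ _ _ _ i11 R1E G1E.
pose g00 := \int[mu]_(z in QT M) (f0 z * r0 z).
pose g01 := \int[mu]_(z in QT M) (f0 z * r1 z).
pose g10 := \int[mu]_(z in QT M) (f1 z * r0 z).
pose g11 := \int[mu]_(z in QT M) (f1 z * r1 z).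
have innerE : inner_QT M (fun t x => rhohat0 t x - rhohat1 t x)
    (fun t x => f_of M rho0 t x - f_of M rho1 t x) = (g00 - g01) - (g10 - g11).
  rewrite -(RintegralB mQ i00 i01) -(RintegralB mQ i10 i11).
  rewrite -(RintegralB mQ (integrableB mQ i00 i01) (integrableB mQ i10 i11)).
  by apply: eq_Rintegral => z _; rewrite /f0 /f1 /r0 /r1; ring.
have eq_inner : ae_eq_evolution M rhohat0 rhohat1 -> (g00 = g01) /\ (g10 = g11).
  move=> /(ae_eq_evolution_QT mr0 mr1) [N [mN N_0 NE]].
  split; rewrite /g00 /g01 /g10 /g11 /Rintegral.
    rewrite (negligible_integral mN mQ i00 N_0).
    rewrite (negligible_integral mN mQ i01 N_0).
    congr fine; apply: eq_integral => z /set_mem[Qz Nz].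
    by rewrite /r0 /r1 /= (NE z Qz Nz).
  rewrite (negligible_integral mN mQ i10 N_0).
  rewrite (negligible_integral mN mQ i11 N_0).
  congr fine; apply: eq_integral => z /set_mem[Qz Nz].
  by rewrite /r0 /r1 /= (NE z Qz Nz).
rewrite innerE; clear innerE JE.
rewrite -[X in (_ + X + _)%:E]/g00 in J00.
rewrite -[X in (_ + X + _)%:E]/g01 in J01.
rewrite -[X in (_ + X + _)%:E]/g10 in J10.
rewrite -[X in (_ + X + _)%:E]/g11 in J11.
clearbody g00 g01 g10 g11.
have opt0 := br0.2 _ _ br1.1; have opt1 := br1.2 _ _ br0.1.
rewrite J00 J01 lee_fin in opt0; rewrite J10 J11 lee_fin in opt1.
(* Adding [opt0] and [opt1] cancels [R0], [R1], [G0], [G1] and leaves [g00 + g11 <= g01 + g10]. *)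
exists (- ((g00 - g01) - (g10 - g11))); split; [by rewrite subrr|lra|].
split=> [D0|/eq_inner[-> ->]]; last by rewrite !subrr oppr0.
(* When [D = 0], replacing [g10 - g11] by [g00 - g01] in [opt1] gives that response 1 costs no more
   than response 0 against [rho0]; uniqueness for [rho0] then identifies the two. *)
have br01 : best_response M rho0 rhohat1 mhat1.
  split=> [|r m /br0.2]; first exact: br1.1.
  by apply: le_trans; rewrite J00 J01 lee_fin; lra.
have [phi [r [_ _ _ _ uniq]]] := wp0.
have [h0 _] := uniq _ _ br0; have [h1 _] := uniq _ _ br01.
by move=> t tT; apply: filterS2 (h0 t tT) (h1 t tT) => x -> ->.
Qed.
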